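(* Let $n,r,m$ be nonnegative integers, and let $f,g_1,\ldots,g_m\in\mathcal V_r$ be polynomials in $(x,\lambda)=(x_1,\ldots,x_n,\lambda_1,\ldots,\lambda_r)$ that are affine in $\lambda$. Let $K=\{(x,\lambda)\in\mathbb R^n\times\mathbb R^r: g_i(x,\lambda)\ge 0,\ i=1,\ldots,m\}$. If the restricted quadratic module $\mathcal M_x(g)$ is restricted Archimedean and $f>0$ on $K$, then $f\in\mathcal M_x(g)$; that is, there exist $\sigma_0,\ldots,\sigma_m\in\Sigma[x]$ with $f=\sigma_0+\sum_{i=1}^m\sigma_i g_i$.
   Context: $\mathcal V_r=\{p_0(x)+\sum_{k=1}^r\lambda_k p_k(x): p_0,\ldots,p_r\in\mathbb R[x]\}\subseteq\mathbb R[x,\lambda]$ is the real vector space of polynomials affine in $\lambda$. $\Sigma[x]$ is the cone of finite sums of squares of polynomials in $\mathbb R[x]$ (the variables $x$ only). For $g=(g_1,\ldots,g_m)\in\mathcal V_r^m$, the restricted quadratic module is $\mathcal M_x(g)=\{\sigma_0+\sum_{i=1}^m\sigma_i g_i:\sigma_0,\ldots,\sigma_m\in\Sigma[x]\}\subseteq\mathcal V_r$. It is called restricted Archimedean if $1$ is an order unit for it in $\mathcal V_r$: for every $p\in\mathcal V_r$ there is $N>0$ such that $N+p$ and $N-p$ both belong to $\mathcal M_x(g)$. The set $K$ is allowed to be empty. *)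

(* Defs.v *)
From mathcomp Require Import all_boot all_order all_algebra.
From mathcomp Require Import reals.
From mathcomp Require Import mpoly.

Set Implicit Arguments.
Unset Strict Implicit.
Unset Printing Implicit Defensive.

Import Order.TTheory GRing.Theory Num.Theory.
Local Open Scope ring_scope.

(* R[x, lambda] is {mpoly R[n + r]}: the indices lshift r i are the variables
   x_i and the indices rshift n k are the variables lambda_k. *)

(* The inclusion of R[x] in R[x, lambda]. *)
Definition xincl (R : realType) (n r : nat) (p : {mpoly R[n]}) :
    {mpoly R[n + r]} :=
  p \mPo [tuple 'X_(lshift r i) | i < n].

(* Membership in V_r. *)
Definition affine_in_lambda (R : realType) (n r : nat)
    (p : {mpoly R[n + r]}) : Prop :=
  exists (p0 : {mpoly R[n]}) (q : 'I_r -> {mpoly R[n]}),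
    p = xincl r p0 + \sum_(k < r) 'X_(rshift n k) * xincl r (q k).

Definition is_sos (R : realType) (n : nat) (s : {mpoly R[n]}) : Prop :=
  exists qs : seq {mpoly R[n]}, s = \sum_(q <- qs) q ^+ 2.

(* Membership in M_x(g); the multipliers involve the variables x only. *)
Definition restricted_quadratic_module (R : realType) (n r m : nat)
    (g : 'I_m -> {mpoly R[n + r]}) (p : {mpoly R[n + r]}) : Prop :=
  exists (s0 : {mpoly R[n]}) (s : 'I_m -> {mpoly R[n]}),
    [/\ is_sos s0, forall i, is_sos (s i)
      & p = xincl r s0 + \sum_(i < m) xincl r (s i) * g i].

Definition restricted_archimedean (R : realType) (n r m : nat)
    (g : 'I_m -> {mpoly R[n + r]}) : Prop :=
  forall p : {mpoly R[n + r]}, affine_in_lambda p ->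
    exists N : R, [/\ 0 < N,
      restricted_quadratic_module g (N%:MP + p)
      & restricted_quadratic_module g (N%:MP - p)].

Definition eval_at (R : realType) (n r : nat) (p : {mpoly R[n + r]})
    (x : 'rV[R]_n) (l : 'rV[R]_r) : R :=
  p.@[row_mx x l 0].

(* Membership of (x, l) in K. *)
Definition nonneg_set (R : realType) (n r m : nat)
    (g : 'I_m -> {mpoly R[n + r]}) (x : 'rV[R]_n) (l : 'rV[R]_r) : Prop :=
  forall i : 'I_m, 0 <= eval_at (g i) x l.

(* Main.v *)
(* Suppose [f] is not in [M = M_x(g)].  Then [-1] is not in [M - Sos f], because
   [s f - 1] in [M] with [s] a sum of squares in [R[x]] would force [f] in [M].
   By Zorn there is a maximal cone [Q] of [V_r]
   stable under squares of [R[x]], containing [M - Sos f] and not [-1].  For such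
   a [Q] one has [V_r = Q \cup -Q], so, [1] being an order unit, every [p] in
   [V_r] is infinitesimally close to a unique real [L p].  The functional [L] is
   multiplicative over [R[x]], hence is the evaluation at the point
   [(L x_i, L lambda_k)], which lies in [K] and satisfies [f <= 0]. *)
Require Import Defs.
From HB Require Import structures.
From mathcomp Require Import all_boot all_order all_algebra.
From mathcomp Require Import boolp classical_sets reals.
From mathcomp Require Import mpoly.
From mathcomp Require Import ring lra.

Import Order.TTheory GRing.Theory Num.Theory.
Local Open Scope ring_scope.

(** * Sums of squares in a commutative ring *)

Definition sum_of_squares (A : comNzRingType) (s : A) : Prop :=
  exists qs : seq A, s = \sum_(q <- qs) q ^+ 2.

Section SumsOfSquares.
Variable A : comNzRingType.
Implicit Types a s t : A.

Lemma sos0 : sum_of_squares A 0.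
Proof. by exists [::]; rewrite big_nil. Qed.

Lemma sos_sqr a : sum_of_squares A (a ^+ 2).
Proof. by exists [:: a]; rewrite big_seq1. Qed.

Lemma sosD {s t} :
  sum_of_squares A s -> sum_of_squares A t -> sum_of_squares A (s + t).
Proof. by move=> [qs ->] [rs ->]; exists (qs ++ rs); rewrite big_cat. Qed.

Lemma sosM_sqr a {s} : sum_of_squares A s -> sum_of_squares A (a ^+ 2 * s).
Proof.
move=> [qs ->]; exists [seq a * q | q <- qs].
by rewrite big_map big_distrr; apply: eq_bigr => q _; rewrite exprMn.
Qed.

Lemma sos_ind (P : A -> Prop) :
    P 0 -> (forall a s, P s -> P (a ^+ 2 + s)) ->
  forall s, sum_of_squares A s -> P s.
Proof.
move=> P0 PD s [qs ->]; elim: qs => [|q qs IH]; first by rewrite big_nil.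
by rewrite big_cons; apply: PD.
Qed.

End SumsOfSquares.

(** * Cones in an [A]-submodule [V] of [B], abstracting V_r as a module over R[x] *)

Section ModuleCones.
Variables (R : realType) (A B : comNzRingType).
Variables (iota : {rmorphism R -> A}) (j : {rmorphism A -> B}) (V : B -> Prop).
Hypotheses (V1 : V 1) (VD : forall p q, V p -> V q -> V (p + q))
  (VM : forall a p, V p -> V (j a * p)).
Implicit Types (a s : A) (p q f : B) (c d e : R) (Q M : B -> Prop).

Local Notation k c := (j (iota c)).
Local Notation sos := (sum_of_squares A).

Lemma Vj a : V (j a).
Proof. by rewrite -[j a]mulr1; apply: VM. Qed.

Lemma VN p : V p -> V (- p).
Proof. by move=> Vp; rewrite -mulN1r -[1](rmorph1 j) -rmorphN; apply: VM. Qed.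

(** Only squares from [A] act, because a product of two elements of [V] may leave [V]. Sums of
    squares then act by additivity, and nonnegative reals act because they are squares. *)
Record module_cone Q : Prop := ModuleCone {
  cone_sub : forall q, Q q -> V q;
  cone1 : Q 1;
  coneD : forall p q, Q p -> Q q -> Q (p + q);
  coneM : forall a q, Q q -> Q (j a ^+ 2 * q) }.

Definition order_unit Q : Prop :=
  forall p, V p -> exists2 c, 0 < c & Q (k c + p).

Section Cone.
Context {Q : B -> Prop}.
Hypothesis Qc : module_cone Q.

Lemma cone0 : Q 0.
Proof. by have := coneM _ Qc 0 _ (cone1 _ Qc); rewrite rmorph0 expr0n mul0r. Qed.

Lemma cone_sosM {s q} : sos s -> Q q -> Q (j s * q).
Proof.
move=> ss Qq; elim/sos_ind: s / ss => [|a s Qs].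
  by rewrite rmorph0 mul0r; apply: cone0.
by rewrite rmorphD mulrDl rmorphXn; apply: coneD => //; apply: coneM.
Qed.

Lemma cone_sos {s} : sos s -> Q (j s).
Proof. by move=> ss; rewrite -[j s]mulr1; apply: cone_sosM => //; apply: cone1. Qed.

Lemma sos_const c : 0 <= c -> sos (iota c).
Proof. by move=> c0; rewrite -(sqr_sqrtr c0) rmorphXn; apply: sos_sqr. Qed.

Lemma coneZ {c q} : 0 <= c -> Q q -> Q (k c * q).
Proof. by move=> c0; apply: cone_sosM; apply: sos_const. Qed.

Lemma coneC {c} : 0 <= c -> Q (k c).
Proof. by move=> c0; apply: cone_sos; apply: sos_const. Qed.

Lemma coneZ_inv c q : 0 < c -> Q (k c * q) -> Q q.
Proof.
move=> c0 /(@coneZ c^-1 _ _); rewrite mulrA -!rmorphM mulVf ?gt_eqF//.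
by rewrite !rmorph1 mul1r invr_ge0; apply; apply: ltW.
Qed.

(** A negative constant in [Q] could be rescaled to -1. *)
Lemma cone_const_ge0 c : ~ Q (-1) -> Q (k c) -> 0 <= c.
Proof.
move=> Qproper Qc'; rewrite leNgt; apply/negP => c0; apply: Qproper.
apply: (@coneZ_inv (- c)); first by rewrite oppr_gt0.
by rewrite mulrN1 !rmorphN opprK.
Qed.

(** For [f] in [V], this is the smallest module cone containing [Q] and [f]. *)
Definition cone_adjoin f : B -> Prop :=
  fun p => exists q s, [/\ Q q, sos s & p = q + j s * f].

Lemma cone_adjoinP f : V f -> module_cone (cone_adjoin f).
Proof.
move=> Vf; split.
- move=> _ [q [s [Qq ss ->]]]; apply: VD; first exact: cone_sub Qc _ Qq.
  exact: VM.
- exists 1, 0; split; [exact: cone1|exact: sos0|by rewrite rmorph0; ring].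
- move=> _ _ [p [s [Qp ss ->]]] [q [t [Qq st ->]]]; exists (p + q), (s + t).
  by split; [apply: coneD|apply: sosD|rewrite rmorphD; ring].
- move=> a _ [q [s [Qq ss ->]]]; exists (j a ^+ 2 * q), (a ^+ 2 * s).
  by split; [apply: coneM|apply: sosM_sqr|rewrite rmorphM rmorphXn; ring].
Qed.

Lemma cone_adjoin_sub f q : Q q -> cone_adjoin f q.
Proof. by move=> Qq; exists q, 0; split => //; [exact: sos0|rewrite rmorph0; ring]. Qed.

Lemma cone_adjoin_mem f : cone_adjoin f f.
Proof.
exists 0, (1 ^+ 2); split; [exact: cone0|exact: sos_sqr|].
by rewrite rmorphXn rmorph1; ring.
Qed.

End Cone.

(* For large [N], adding elements of [M] to [(N - s)^2 (f + c)] gives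
   [N^2 (f + c - N^-2)], so the constant [c] can be lowered by [N^-2]. *)
Lemma cone_cancel_sos M f s : module_cone M -> order_unit M -> V f ->
  sos s -> M (j s * f - 1) -> M f.
Proof.
move=> Mc Mu Vf ss Msf.
have [N1 N10 MN1] := Mu _ (VN _ (Vj s)).
have [N2 N20 MN2] : exists2 c, 0 < c & M (k c + (- (j s * (j s * f)) - 1)).
  by apply: Mu; apply: VD; apply: VN => //; do 2!apply: VM.
(* Taking the sum lets a single [N] serve both bounds, on [s] and on [s^2 f + 1]. *)
pose N := N1 + N2; have N0 : 0 < N by rewrite addr_gt0.
have {MN1} MN1 : M (2 * k N - j s).
  have -> : 2 * k N - j s = k (N1 + 2 * N2) + (k N1 + - j s).
    by rewrite /N !rmorphD !rmorphM; ring.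
  by apply: coneD => //; apply: coneC => //; lra.
have {MN2} MN2 : M (2 * k N - j s ^+ 2 * f - 1).
  have -> : 2 * k N - j s ^+ 2 * f - 1
      = k (2 * N1 + N2) + (k N2 + (- (j s * (j s * f)) - 1)).
    by rewrite /N !rmorphD !rmorphM; ring.
  by apply: coneD => //; apply: coneC => //; lra.
have step c : 0 <= c -> M (k c + f) -> M (k (c - N ^- 2) + f).
  move=> c0 Mcf; apply: (@coneZ_inv _ Mc (N ^+ 2)); first by rewrite exprn_gt0.
  have -> : k (N ^+ 2) * (k (c - N ^- 2) + f)
      = k (N ^+ 2 * (c - N ^- 2)) + k (N ^+ 2) * f.
    by rewrite mulrDr -!rmorphM.
  rewrite mulrBr divff ?gt_eqF ?exprn_gt0//.
  (* The last three terms cancel everything in [(N - s)^2 (c + f)] that contains [s]; what remains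
     besides [N^2 (c + f)] is the gain -1. The term [c s (2N - s)] is in [M] because [c] is
     nonnegative. *)
  have -> : k (N ^+ 2 * c - 1) + k (N ^+ 2) * f
    = j (iota N - s) ^+ 2 * (k c + f) + k (2 * N) * (j s * f - 1)
      + k c * (j s * (2 * k N - j s)) + (2 * k N - j s ^+ 2 * f - 1) by ring.
  apply: coneD => //; apply: coneD => //; first apply: coneD => //.
  - exact: coneM.
  - by apply: coneZ => //; lra.
  - by apply: coneZ => //; apply: cone_sosM.
have [c0 c00 Mc0] := Mu _ Vf.
(* The decrement does not depend on [c], so finitely many steps bring the constant below 0. Once it
   is negative, adding its opposite gives [f] itself. *)
have descent n : M (k (c0 - n%:R * N ^- 2) + f) \/ M f.
  elim: n => [|n [IH|]]; [by left; rewrite mul0r subr0| |by right].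
  have [cn|cn] := lerP 0 (c0 - n%:R * N ^- 2).
    left; have := step _ cn IH.
    by congr (M (k _ + f)); rewrite -natr1; ring.
  right; have -> : f = k (- (c0 - n%:R * N ^- 2)) + (k (c0 - n%:R * N ^- 2) + f).
    by rewrite !rmorphN; ring.
  by apply: coneD => //; apply: coneC => //; lra.
have [m hm] : exists m : nat, c0 < m%:R * N ^- 2.
  exists (Num.bound (c0 * N ^+ 2)).
  rewrite ltr_pdivlMr ?exprn_gt0//.
  by apply: archi_boundP; rewrite mulr_ge0 ?exprn_ge0// ltW.
have [Mm|//] := descent m.
have -> : f = k (m%:R * N ^- 2 - c0) + (k (c0 - m%:R * N ^- 2) + f).
  by rewrite !rmorphB; ring.
by apply: coneD => //; apply: coneC => //; lra.
Qed.

(** Zorn applies because each closure condition involves at most two elements, which lie together in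
    one member of a chain. Maximality is recorded in the form used later: adjoining a missing
    element of [V] produces -1. *)
Lemma exists_maximal_cone M : module_cone M -> ~ M (-1) ->
  exists Q, [/\ module_cone Q, forall p, M p -> Q p, ~ Q (-1) &
    forall p, V p -> ~ Q p -> cone_adjoin (Q := Q) p (-1)].
Proof.
move=> Mc Mproper.
(* The union with [M] makes the empty chain harmless. *)
pose P (X : set B) := module_cone (X `|` M)%classic /\ ~ (X `|` M)%classic (-1).
have [] := @Zorn_bigcup B P.
  move=> F FP Ftot; rewrite /P.
  have UF p : ((\bigcup_(X in F) X) `|` M)%classic p ->
      M p \/ exists2 X, F X & X p.
    by case=> [[X FX Xp]|]; [right; exists X|left].
  have FU X p : F X -> (X `|` M)%classic p ->
      ((\bigcup_(X in F) X) `|` M)%classic p.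
    by move=> FX [Xp|]; [left; exists X|right].
  split; last first.
    by move=> /UF [//|[X FX X1]]; have [_ []] := FP _ FX; left.
  split.
  - move=> q /UF [/(cone_sub _ Mc)//|[X FX Xq]].
    by have [Xc _] := FP _ FX; apply: (cone_sub _ Xc); left.
  - by right; apply: cone1.
  - move=> p q /UF [Mp|[X FX Xp]] /UF [Mq|[Y FY Yq]].
    + by right; apply: coneD.
    + have [Yc _] := FP _ FY; apply: (FU _ _ FY).
      by apply: (coneD _ Yc); [right|left].
    + have [Xc _] := FP _ FX; apply: (FU _ _ FX).
      by apply: (coneD _ Xc); [left|right].
    + have [Xc _] := FP _ FX; have [Yc _] := FP _ FY.
      have [XY|YX] := Ftot _ _ FX FY.
        by apply: (FU _ _ FY); apply: (coneD _ Yc); left => //; apply: XY.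
      by apply: (FU _ _ FX); apply: (coneD _ Xc); left => //; apply: YX.
  - move=> a q /UF [Mq|[X FX Xq]]; first by right; apply: coneM.
    have [Xc _] := FP _ FX; apply: (FU _ _ FX).
    by apply: (coneM _ Xc); left.
move=> Q0 [[Qc Qproper] Qmax]; exists (Q0 `|` M)%classic; split => //.
  by move=> p Mp; right.
set Q := (Q0 `|` M)%classic in Qc Qproper *.
move=> p Vp Qp; apply: contrapT => adj1.
have QE q : Q q -> cone_adjoin (Q := Q) p q by apply: cone_adjoin_sub.
(* The enlarged cone already contains [M], so the union built into [P] leaves it unchanged. *)
have EM : (cone_adjoin (Q := Q) p `|` M)%classic = cone_adjoin (Q := Q) p.
  by apply/seteqP; split=> q; [case=> // Mq; apply: QE; right|left].
apply: (Qmax (cone_adjoin (Q := Q) p)).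
  split; first by move=> q Qq; apply: QE; left.
  by move=> /(_ p (cone_adjoin_mem Qc p)) Q0p; apply: Qp; left.
by rewrite /P EM; split => //; apply: cone_adjoinP.
Qed.

(** If both [p] and [- p] were missing, then -1 = q + s p = q' - s' p. Eliminating [p] gives -s = s'
    + s' q + s q' in [Q]. As [N + p] is in [Q], so is s p = s (N + p) - N s. *)
Lemma maximal_cone_total Q : module_cone Q -> order_unit Q ->
    (forall p, V p -> ~ Q p -> cone_adjoin (Q := Q) p (-1)) ->
  forall p, V p -> Q p \/ Q (- p).
Proof.
move=> Qc Qu Qmax p Vp; apply: contrapT => /not_orP [Qp QNp].
have [q [s [Qq ss e1]]] := Qmax _ Vp Qp.
have [q' [s' [Qq' ss' e2]]] := Qmax _ (VN _ Vp) QNp.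
have QNs : Q (- j s).
  have -> : - j s = j s' + (j s' * q + j s * q').
    have -> : q = -1 - j s * p by rewrite e1; ring.
    have -> : q' = -1 - j s' * - p by rewrite e2; ring.
    by ring.
  by apply: coneD; [|exact: cone_sos|apply: coneD => //; apply: cone_sosM].
have [N N0 QN] := Qu _ Vp.
have Qsp : Q (j s * p).
  have -> : j s * p = j s * (k N + p) + k N * - j s by ring.
  by apply: coneD => //; [apply: cone_sosM|apply: coneZ => //; apply: ltW].
(* Now -1 = q + s p is in [Q], and the order unit turns this into membership of [p]. *)
apply: Qp; have [N' N'0 QN'] := Qu _ Vp.
have -> : p = (k N' + p) + k N' * (-1) by ring.
apply: coneD => //; apply: coneZ => //; first exact: ltW.
by rewrite e1; apply: coneD.
Qed.

(** * Standard parts with respect to a total proper cone *)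

Section StandardPart.
Context {Q : B -> Prop}.
Hypotheses (Qc : module_cone Q) (Qu : order_unit Q) (Qproper : ~ Q (-1))
  (Qtotal : forall p, V p -> Q p \/ Q (- p)).

Definition infinitesimal p : Prop :=
  forall e, 0 < e -> Q (k e + p) /\ Q (k e - p).

Definition has_standard_part p c : Prop := infinitesimal (p - k c).

Lemma infinitesimalD {p q} :
  infinitesimal p -> infinitesimal q -> infinitesimal (p + q).
Proof.
move=> ip iq e e0; have e20 : 0 < e / 2 by lra.
have [p1 p2] := ip _ e20; have [q1 q2] := iq _ e20.
have -> : k e = k (e / 2) + k (e / 2) by rewrite -!rmorphD; congr (k _); field.
rewrite opprD; split; first by rewrite addrACA; apply: coneD.
by rewrite addrACA; apply: coneD.
Qed.

Lemma infinitesimalN p : infinitesimal p -> infinitesimal (- p).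
Proof. by move=> ip e e0; have [p1 p2] := ip _ e0; rewrite opprK. Qed.

Lemma infinitesimalZ c p : infinitesimal p -> infinitesimal (k c * p).
Proof.
wlog c0 : c p / 0 <= c.
  move=> H ip; have [c0|c0] := lerP 0 c; first exact: H.
  have -> : k c * p = k (- c) * (- p) by ring.
  by apply: H; [rewrite oppr_ge0 ltW|exact: infinitesimalN].
move=> ip e e0; move: c0; rewrite le_eqVlt => /orP [/eqP <-|c0].
  by rewrite !rmorph0 mul0r subr0 addr0; split; apply: coneC => //; apply: ltW.
have [p1 p2] := ip _ (divr_gt0 e0 c0).
have -> : k e = k c * k (e / c) by rewrite -!rmorphM mulrC divfK ?gt_eqF.
by rewrite -mulrBr -mulrDr; split; apply: coneZ => //; apply: ltW.
Qed.

Lemma infinitesimal_const c : infinitesimal (k c) -> c = 0.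
Proof.
move=> ic; apply/eqP; rewrite eq_le; apply/andP; split.
  apply/ler_addgt0Pr => e e0; have [_] := ic _ e0.
  by rewrite -!rmorphB => /(cone_const_ge0 Qc _ Qproper); lra.
apply/ler_addgt0Pr => e e0; have [+ _] := ic _ e0.
by rewrite -!rmorphD => /(cone_const_ge0 Qc _ Qproper); lra.
Qed.

(** Polarization replaces multiplication inside [V]: weighting [N + p] and [N - p] by the squares of
    [a + t] and [a - t] isolates [a p], up to [N a^2 + N t^2], which is small when [a] is
    infinitesimal and [t] is small. *)
Lemma infinitesimal_mulr a p : infinitesimal (j a) -> V p -> infinitesimal (j a * p).
Proof.
move=> ia Vp.
have [N1 N10 QN1] := Qu _ Vp; have [N2 N20 QN2] := Qu _ (VN _ Vp).
pose N := N1 + N2; have N0 : 0 < N by rewrite addr_gt0.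
have {QN1} QN1 : Q (k N + p).
  by rewrite /N !rmorphD addrAC addrC; apply: coneD => //; apply: coneC => //; lra.
have {QN2} QN2 : Q (k N - p).
  by rewrite /N !rmorphD -addrA; apply: coneD => //; apply: coneC => //; lra.
(* [Q] need not contain the product of [d + a] and [d - a], so each factor is multiplied by the
   square of the other; the sum is this product times [2 d]. *)
have sqr_small d : 0 < d -> Q (k (d ^+ 2) - j a ^+ 2).
  move=> d0; have [Qa QNa] := ia _ d0.
  apply: (@coneZ_inv _ Qc (2 * d)); first by rewrite mulr_gt0.
  have -> : k (2 * d) * (k (d ^+ 2) - j a ^+ 2)
    = j (iota d - a) ^+ 2 * (k d + j a) + j (iota d + a) ^+ 2 * (k d - j a) by ring.
  by apply: coneD => //; apply: coneM.
have key t : Q (k N * j a ^+ 2 + k (2 * t) * (j a * p) + k (N * t ^+ 2)).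
  apply: (@coneZ_inv _ Qc 2) => //.
  have -> : k 2 * (k N * j a ^+ 2 + k (2 * t) * (j a * p) + k (N * t ^+ 2))
    = j (a + iota t) ^+ 2 * (k N + p) + j (a - iota t) ^+ 2 * (k N - p) by ring.
  by apply: coneD => //; apply: coneM.
(* Here [t = d], and [a^2] is bounded by [d^2]. Either sign of [d] is allowed: [d = e / N] and
   [d = - (e / N)] give [e + a p] and [e - a p], each times [e / N]. *)
have key2 d : d != 0 -> Q (k (N * d ^+ 2) + k d * (j a * p)).
  move=> d0; apply: (@coneZ_inv _ Qc 2) => //.
  have -> : k 2 * (k (N * d ^+ 2) + k d * (j a * p))
    = k N * (k (`|d| ^+ 2) - j a ^+ 2)
      + (k N * j a ^+ 2 + k (2 * d) * (j a * p) + k (N * d ^+ 2)).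
    by rewrite real_normK ?num_real//; ring.
  by apply: coneD => //; apply: coneZ; [|exact: ltW|apply: sqr_small; rewrite normr_gt0].
move=> e e0; have d0 : 0 < e / N by rewrite divr_gt0.
have eE : e = N * (e / N) by rewrite mulrC divfK ?gt_eqF.
split; apply: (coneZ_inv Qc _ _ d0).
  have := key2 (e / N) (lt0r_neq0 d0).
  by congr (Q _); rewrite [in k e]eE; ring.
have := key2 (- (e / N)); rewrite oppr_eq0 => /(_ (lt0r_neq0 d0)).
by congr (Q _); rewrite [in k e]eE; ring.
Qed.

(** The standard part is the supremum of the constants below [p]; the order unit makes this set
    nonempty and bounded. Totality gives the upper estimate, since [sup S + e] is not in [S]. *)
Lemma exists_standard_part p : V p -> exists c, has_standard_part p c.
Proof.
move=> Vp; pose S : set R := [set c | Q (p - k c)]%classic.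
have Sub c d : S c -> Q (k d - p) -> c <= d.
  move=> Sc Qd; have := coneD _ Qc _ _ Sc Qd.
  have -> : p - k c + (k d - p) = k (d - c) by ring.
  by move=> /(cone_const_ge0 Qc _ Qproper); rewrite subr_ge0.
have [N N0 QN] := Qu _ Vp; have [N' N'0 QN'] := Qu _ (VN _ Vp).
have Ssup : has_sup S.
  split; last by exists N' => c Sc; apply: Sub.
  by exists (- N); rewrite /S /= !rmorphN opprK addrC.
exists (sup S) => e e0; split.
  have [c Sc cS] := sup_adherent e0 Ssup.
  have -> : k e + (p - k (sup S)) = k (c - (sup S - e)) + (p - k c) by ring.
  by apply: coneD => //; apply: coneC => //; lra.
have [|Se|] := Qtotal (p - k (sup S + e)).
- by apply: VD => //; apply: VN; apply: Vj.
- by have := @sup_upper_bound _ _ Ssup _ Se; lra.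
- by congr (Q _); ring.
Qed.

Lemma standard_part_unique {p c d} :
  has_standard_part p c -> has_standard_part p d -> c = d.
Proof.
move=> pc pd; apply/eqP; rewrite -subr_eq0; apply/eqP/infinitesimal_const.
have -> : k (c - d) = (p - k d) + (k c - p) by ring.
apply: infinitesimalD => // e e0; have [h1 h2] := pc _ e0.
by rewrite -(opprB p) opprK; split.
Qed.

Lemma standard_part_const c : has_standard_part (k c) c.
Proof. by move=> e e0; rewrite subrr subr0 addr0; split; apply: coneC => //; apply: ltW. Qed.

Lemma standard_partD {p q c d} :
  has_standard_part p c -> has_standard_part q d -> has_standard_part (p + q) (c + d).
Proof.
move=> pc qd; have -> : p + q = (p - k c) + (q - k d) + k (c + d) by ring.
by rewrite /has_standard_part addrK; apply: infinitesimalD.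
Qed.

Lemma standard_partM {a p c d} : V p ->
  has_standard_part (j a) c -> has_standard_part p d ->
  has_standard_part (j a * p) (c * d).
Proof.
move=> Vp ac pd; rewrite /has_standard_part.
have -> : j a * p - k (c * d) = j (a - iota c) * p + k c * (p - k d) by ring.
apply: infinitesimalD.
  by apply: infinitesimal_mulr => //; rewrite rmorphB.
exact: infinitesimalZ.
Qed.

Lemma standard_part_ge0 p c : Q p -> has_standard_part p c -> 0 <= c.
Proof.
move=> Qp pc; apply/ler_addgt0Pr => e e0; rewrite addrC.
apply: (cone_const_ge0 Qc _ Qproper).
have -> : k (e + c) = p + (k e - (p - k c)) by ring.
by apply: coneD => //; have [] := pc _ e0.
Qed.

End StandardPart.

(** [L] is the standard part for a maximal cone containing [M] and [- f]. *)
Lemma exists_nonpos_evaluation M f :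
    module_cone M -> order_unit M -> V f -> ~ M f ->
  exists L : B -> R,
    [/\ forall c, L (k c) = c,
        forall p q, V p -> V q -> L (p + q) = L p + L q,
        forall a p, V p -> L (j a * p) = L (j a) * L p,
        forall p, M p -> 0 <= L p
      & L f <= 0].
Proof.
move=> Mc Mu Vf Mf.
have VNf := VN _ Vf.
(* If -1 = q - s f with [q] in [M], then s f - 1 = q is in [M], and [cone_cancel_sos] puts [f] in
   [M]. *)
have adj_proper : ~ cone_adjoin (Q := M) (- f) (-1).
  move=> [q [s [Mq ss e1]]]; apply: Mf; apply: (cone_cancel_sos _ _ s) => //.
  by rewrite e1 mulrN addrCA subrr addr0.
have [Q [Qc adjQ Qproper Qmax]] :=
  exists_maximal_cone _ (cone_adjoinP Mc _ VNf) adj_proper.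
have MQ p : M p -> Q p by move=> Mp; apply: adjQ; apply: cone_adjoin_sub.
have Qu : order_unit Q.
  by move=> p Vp; have [c c0 Mp] := Mu _ Vp; exists c => //; apply: MQ.
have Qtotal := maximal_cone_total _ Qc Qu Qmax.
(* Outside [V] the values of [L] are arbitrary, hence the assumptions [V p] in its properties. *)
have /choice [L LP] p : exists c, V p -> has_standard_part (Q := Q) p c.
  have [Vp|nVp] := pselect (V p); last by exists 0.
  by have [c cP] := exists_standard_part Qc Qu Qproper Qtotal _ Vp; exists c.
have Luniq p c : V p -> has_standard_part (Q := Q) p c -> L p = c.
  by move=> Vp; apply: (standard_part_unique Qc Qproper); apply: LP.
exists L; split.
- by move=> c; apply: Luniq; [exact: Vj|exact: standard_part_const].
- move=> p q Vp Vq; apply: Luniq; first exact: VD.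
  by apply: standard_partD => //; apply: LP.
- move=> a p Vp; apply: Luniq; first exact: VM.
  by apply: standard_partM => //; apply: LP => //; apply: Vj.
- move=> p Mp; apply: (standard_part_ge0 Qc Qproper p); first exact: MQ.
  by apply: LP; apply: cone_sub Mc _ Mp.
- have -> : L f = - L (- f).
    have L0 : L 0 = 0.
      have -> : (0 : B) = k 0 by rewrite !rmorph0.
      by apply: Luniq; [exact: Vj|exact: standard_part_const].
    apply/eqP; rewrite -addr_eq0; apply/eqP; rewrite -L0 -(subrr f).
    symmetry; apply: Luniq; first exact: VD.
    by apply: standard_partD => //; apply: LP.
  rewrite oppr_le0; apply: (standard_part_ge0 Qc Qproper (- f)); last exact: LP.
  by apply: adjQ; apply: cone_adjoin_mem.
Qed.

End ModuleCones.

(** * The restricted quadratic module and evaluations on V_r *)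

HB.instance Definition _ (R : realType) (n r : nat) :=
  GRing.RMorphism.copy (@xincl R n r) (@comp_mpoly _ _ _ _).

Section RestrictedQuadraticModule.
Variables (R : realType) (n r : nat).
Local Notation A := {mpoly R[n]}.
Local Notation B := {mpoly R[n + r]}.
Implicit Types (a : A) (p q : B).

Lemma xinclC (c : R) : xincl r (c%:MP : A) = c%:MP.
Proof. exact: comp_mpolyC. Qed.

Lemma xinclX (i : 'I_n) : xincl r ('X_i : A) = 'X_(lshift r i).
Proof. by rewrite /xincl comp_mpolyXU -tnth_nth tnth_mktuple. Qed.

Lemma affine1 : affine_in_lambda (1 : B).
Proof.
exists 1, (fun=> 0); rewrite rmorph1 big1 ?addr0// => i _.
by rewrite rmorph0 mulr0.
Qed.

Lemma affineX (k : 'I_r) : affine_in_lambda ('X_(rshift n k) : B).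
Proof.
exists 0, (fun i => (i == k)%:R); rewrite rmorph0 add0r (bigD1 k)//= eqxx.
rewrite rmorph1 mulr1 big1 ?addr0// => i /negPf ->.
by rewrite rmorph0 mulr0.
Qed.

Lemma affineD p q :
  affine_in_lambda p -> affine_in_lambda q -> affine_in_lambda (p + q).
Proof.
move=> [p0 [ps ->]] [q0 [qs ->]]; exists (p0 + q0), (fun i => ps i + qs i).
rewrite rmorphD addrACA -big_split; congr (_ + _); apply: eq_bigr => i _.
by rewrite rmorphD mulrDr.
Qed.

Lemma affineM a p : affine_in_lambda p -> affine_in_lambda (xincl r a * p).
Proof.
move=> [p0 [ps ->]]; exists (a * p0), (fun i => a * ps i).
rewrite rmorphM mulrDr; congr (_ + _); rewrite mulr_sumr; apply: eq_bigr => i _.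
by rewrite rmorphM mulrCA.
Qed.

Lemma restricted_quadratic_module_cone m (g : 'I_m -> B) :
    (forall i, affine_in_lambda (g i)) ->
  module_cone _ _ (@xincl R n r) (@affine_in_lambda R n r)
    (restricted_quadratic_module g).
Proof.
move=> gV; split.
- move=> _ [s0 [s [_ _ ->]]]; apply: affineD.
    by rewrite -[xincl r s0]mulr1; apply: affineM; exact: affine1.
  apply: big_ind => [||i _]; [|exact: affineD|exact: affineM].
  by rewrite -[0](mul0r 1) -(rmorph0 (@xincl R n r)); apply: affineM; exact: affine1.
- exists (1 ^+ 2), (fun=> 0); split=> [||]; first exact: sos_sqr.
    by move=> _; apply: sos0.
  rewrite rmorphXn rmorph1 expr1n big1 ?addr0// => i _.
  by rewrite rmorph0 mul0r.
- move=> _ _ [s0 [s [ss0 ss ->]]] [t0 [t [st0 st ->]]].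
  exists (s0 + t0), (fun i => s i + t i); split; first exact: sosD.
    by move=> i; apply: sosD; [exact: ss|exact: st].
  rewrite rmorphD addrACA -big_split; congr (_ + _); apply: eq_bigr => i _.
  by rewrite rmorphD mulrDl.
- move=> a _ [s0 [s [ss0 ss ->]]].
  exists (a ^+ 2 * s0), (fun i => a ^+ 2 * s i); split; first exact: sosM_sqr.
    by move=> i; apply: sosM_sqr; exact: ss.
  rewrite mulrDr rmorphM rmorphXn; congr (_ + _); rewrite mulr_sumr.
  by apply: eq_bigr => i _; rewrite rmorphM rmorphXn mulrA.
Qed.

Lemma restricted_quadratic_module_gen m (g : 'I_m -> B) i :
  restricted_quadratic_module g (g i).
Proof.
exists 0, (fun k => (k == i)%:R); split; first exact: sos0.
  move=> k; case: (k == i); last exact: sos0.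
  by rewrite -(expr1n _ 2); exact: sos_sqr.
rewrite rmorph0 add0r (bigD1 i)//= eqxx rmorph1 mul1r.
by rewrite big1 ?addr0// => k /negPf ->; rewrite rmorph0 mul0r.
Qed.

(** Constants and variables generate R[x] as a ring. This form suits a functional known only to
    respect sums and products. *)
Lemma mpoly_ring_ind (P : A -> Prop) :
    (forall c : R, P c%:MP) -> (forall i, P 'X_i) ->
    (forall a b, P a -> P b -> P (a + b)) ->
    (forall a b, P a -> P b -> P (a * b)) ->
  forall a, P a.
Proof.
move=> PC PX PD PM; elim/mpolyind => [|c mu a _ _ Pa].
  by rewrite -mpolyC0; apply: PC.
apply: PD => //; rewrite -mul_mpolyC; apply: (PM _ _ (PC c)).
rewrite mpolyXE_id; apply: big_ind => [||i _]; [by rewrite -mpolyC1|exact: PM|].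
elim: (mu i) => [|k IH]; first by rewrite expr0 -mpolyC1.
by rewrite exprS; apply: PM.
Qed.

(** On R[x], [L] is a ring morphism fixing the constants, hence a point evaluation. Each lambda_k
    occurs only linearly with a coefficient in R[x], so multiplicativity over R[x] settles the
    remaining terms. *)
Lemma evaluation_eval_at (L : B -> R) :
    (forall c : R, L c%:MP = c) ->
    (forall p q, affine_in_lambda p -> affine_in_lambda q -> L (p + q) = L p + L q) ->
    (forall a p, affine_in_lambda p -> L (xincl r a * p) = L (xincl r a) * L p) ->
  exists (x : 'rV[R]_n) (l : 'rV[R]_r),
    forall p, affine_in_lambda p -> L p = eval_at p x l.
Proof.
move=> LC LD LM.
exists (\row_i L 'X_(lshift r i)), (\row_k L 'X_(rshift n k)) => p.
set x := \row_i _; set l := \row_k _.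
have xV a : affine_in_lambda (xincl r a).
  by rewrite -[xincl r a]mulr1; apply: affineM; exact: affine1.
have Lx a : L (xincl r a) = eval_at (xincl r a) x l.
  elim/mpoly_ring_ind: a => [c|i|a b La Lb|a b La Lb].
  - by rewrite xinclC LC /eval_at mevalC.
  - by rewrite xinclX /eval_at mevalXU row_mxEl mxE.
  - rewrite rmorphD LD; [|exact: xV..].
    by rewrite La Lb /eval_at mevalD.
  - rewrite rmorphM LM; last exact: xV.
    by rewrite La Lb /eval_at mevalM.
move=> [p0 [q ->]].
have LX k : L ('X_(rshift n k) * xincl r (q k)) =
    eval_at ('X_(rshift n k) * xincl r (q k)) x l.
  rewrite mulrC LM; last exact: affineX.
  by rewrite Lx /eval_at mevalM mevalXU row_mxEr mxE.
have VX k : affine_in_lambda ('X_(rshift n k) * xincl r (q k)).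
  by rewrite mulrC; apply: affineM; exact: affineX.
have V0 : affine_in_lambda (0 : B) by have := xV 0; rewrite rmorph0.
(* Membership in V_r is carried through the induction because [L] is additive only there. *)
suff [VS LS] : affine_in_lambda (\sum_(k < r) 'X_(rshift n k) * xincl r (q k))
    /\ L (\sum_(k < r) 'X_(rshift n k) * xincl r (q k))
       = eval_at (\sum_(k < r) 'X_(rshift n k) * xincl r (q k)) x l.
  by rewrite LD// Lx LS /eval_at mevalD.
apply: (big_ind (fun p => affine_in_lambda p /\ L p = eval_at p x l)).
- by split=> //; rewrite -mpolyC0 LC /eval_at mevalC.
- move=> a b [Va La] [Vb Lb]; split; first exact: affineD.
  by rewrite LD// La Lb /eval_at mevalD.
- by [].
Qed.

End RestrictedQuadraticModule.

Theorem theorem3p7 (R : realType) (n r m : nat)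
    (f : {mpoly R[n + r]}) (g : 'I_m -> {mpoly R[n + r]})
    (f_affine : affine_in_lambda f)
    (g_affine : forall i : 'I_m, affine_in_lambda (g i))
    (g_archimedean : restricted_archimedean g)
    (f_pos : forall (x : 'rV[R]_n) (l : 'rV[R]_r),
        nonneg_set g x l -> 0 < eval_at f x l) :
  restricted_quadratic_module g f.
Proof.
apply: contrapT => Mf.
have Mu : order_unit R _ _ (@mpolyC n R) (@xincl R n r)
    (@affine_in_lambda R n r) (restricted_quadratic_module g).
  by move=> p /g_archimedean [N [N0 MN _]]; exists N => //=; rewrite xinclC.
have [L [LC LD LM L0 Lf]] := exists_nonpos_evaluation _ _ _ _ _ _
  (@affine1 R n r) (@affineD R n r) (@affineM R n r) _ _
  (restricted_quadratic_module_cone _ _ _ _ _ g_affine) Mu f_affine Mf.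
have LMP (c : R) : L c%:MP = c by rewrite -[RHS]LC /= xinclC.
have [x [l Leval]] := evaluation_eval_at _ _ _ L LMP LD LM.
(* Nonnegativity of [L] on each [g i] places the point in K, where [f] takes the value [L f <= 0].
   An empty K is contradicted in the same way. *)
have := f_pos x l; rewrite -Leval// ltNge Lf => /(_ _)/negP; apply=> // i.
by rewrite -Leval//; apply: L0; exact: restricted_quadratic_module_gen.
Qed.
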